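(* Let $\mathbf{T}_\varphi$ be an HPD Toeplitz matrix with continuous symbol $\varphi$ on the unit circle $\mathbb{T}$ such that $\inf_{z\in\mathbb{T}}\varphi(z)>0$. Then the matrix $\mathbf{A}_\varphi=\overline{\mathbf{B}}\mathbf{B}^{t}$, where $\mathbf{B}$ is the transition matrix associated with $\mathbf{T}_\varphi$, is weakly asymptotic Toeplitz and $\operatorname{Lim}(\mathbf{A}_\varphi)=\mathbf{T}_{1/\varphi}$.
   Context: For a function $\psi$ on $\mathbb{T}$, $\mathbf{T}_\psi=(t_{m-n})_{m,n=0}^\infty$ with $t_n=\frac1{2\pi}\int_0^{2\pi}\psi(e^{i\theta})e^{-in\theta}\,d\theta$, $n\in\mathbb{Z}$; $\psi$ is called the symbol. An infinite complex matrix $\mathbf{M}=(c_{i,j})_{i,j=0}^\infty$ is HPD if $c_{i,j}=\overline{c_{j,i}}$ for all $i,j$ and $\det(c_{i,j})_{i,j=0}^n>0$ for all $n\ge0$. It defines an inner product on $\mathbb{C}[z]$ by $\langle z^i,z^j\rangle=c_{i,j}$ (linear in the first variable), with orthonormal polynomials $P_n(z)=\sum_{k=0}^n b_{k,n}z^k$, $b_{n,n}>0$, $\langle P_n,P_m\rangle=\delta_{n,m}$; the transition matrix is the upper triangular matrix $\mathbf{B}=(b_{k,n})_{k,n=0}^\infty$ ($b_{k,n}=0$ for $k>n$). $\overline{\mathbf{B}}\mathbf{B}^t$ is the formal product with entries $\sum_{k\ge\max\{i,j\}}\overline{b_{i,k}}\,b_{j,k}$, defined when these series converge for all $i,j$.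 An infinite matrix $(a_{i,j})_{i,j=0}^\infty$ is weakly asymptotic Toeplitz if for every $k\in\mathbb{Z}$ the limit $\alpha_k=\lim_{n\to\infty}a_{n,n+k}$ exists, and then $\operatorname{Lim}((a_{i,j}))$ is the Toeplitz matrix $(\alpha_{j-i})_{i,j=0}^\infty$. *)

(* Defs.v *)
From mathcomp Require Export all_boot all_order all_algebra.
From mathcomp Require Export complex.
From mathcomp Require Export all_classical all_reals all_analysis.

Set Implicit Arguments.
Unset Strict Implicit.
Unset Printing Implicit Defensive.

Import Order.TTheory GRing.Theory Num.Theory.
Export numFieldNormedType.Exports.

Local Open Scope classical_set_scope.
Local Open Scope complex_scope.
Local Open Scope ring_scope.

(* R[i] itself carries no topology; viewed as a numClosedFieldType it gets the
   one that MathComp-Analysis attaches to every numFieldType, induced by the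
   modulus. *)
Definition Cx (R : realType) : numClosedFieldType := R[i].

Definition toCx (R : realType) (x : R) : Cx R := x%:C.

Definition expi (R : realType) (t : R) : Cx R := cos t +i* sin t.

Definition unit_circle (R : realType) : set (Cx R) := [set z | `|z| = 1].
Arguments unit_circle R : clear implicits.

Definition Cintegral (R : realType) (D : set R) (f : R -> Cx R) : Cx R :=
  Rintegral lebesgue_measure D (fun t => complex.Re (f t)) +i*
  Rintegral lebesgue_measure D (fun t => complex.Im (f t)).

Definition fourier_coef (R : realType) (psi : Cx R -> Cx R) (n : int) : Cx R :=
  toCx (1 / (2 * pi)) *
  Cintegral `[0, 2 * pi] (fun t => psi (expi t) * expi (- (n%:~R * t))).

Definition infmx (R : realType) := nat -> nat -> Cx R.

Definition toeplitz (R : realType) (psi : Cx R -> Cx R) : infmx R :=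
  fun m n => fourier_coef psi (m%:Z - n%:Z).

(* In R[i], 0 < z means that z is real and positive. *)
Definition HPD (R : realType) (M : infmx R) : Prop :=
  (forall i j, M i j = (M j i)^*) /\
  (forall n, 0 < \det (\matrix_(i < n.+1, j < n.+1) M i j)).

Definition inner (R : realType) (M : infmx R) (p q : {poly Cx R}) : Cx R :=
  \sum_(i < size p) \sum_(j < size q) p`_i * (q`_j)^* * M i j.

Definition orthonormal_polys (R : realType) (M : infmx R)
    (P : nat -> {poly Cx R}) : Prop :=
  [/\ forall n, size (P n) = n.+1,
      forall n, 0 < (P n)`_n
    & forall n m, inner M (P n) (P m) = (n == m)%:R].

Definition transition_matrix (R : realType) (P : nat -> {poly Cx R}) :
    infmx R :=
  fun k n => (P n)`_k.

Definition conj_mul_tr_partial (R : realType) (B : infmx R) (i j : nat) :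
    nat -> Cx R :=
  fun N => \sum_(maxn i j <= k < N) (B i k)^* * B j k.

Definition conj_mul_tr_defined (R : realType) (B : infmx R) : Prop :=
  forall i j, cvgn (conj_mul_tr_partial B i j).

Definition conj_mul_tr (R : realType) (B : infmx R) : infmx R :=
  fun i j => limn (conj_mul_tr_partial B i j).

(* The column index n + k is negative for the finitely many n < - k; the
   absolute value there is a dummy that does not affect limits. *)
Definition shifted_diag (R : realType) (a : infmx R) (k : int) : nat -> Cx R :=
  fun n => a n (absz (n%:Z + k)).

Definition weakly_asymptotic_toeplitz (R : realType) (a : infmx R) : Prop :=
  forall k : int, cvgn (shifted_diag a k).

Definition Lim (R : realType) (a : infmx R) : infmx R :=
  fun i j => limn (shifted_diag a (j%:Z - i%:Z)).

(* Main.v *)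
Require Import Defs.
From mathcomp Require Import ring lra zify.

Set Implicit Arguments.
Unset Strict Implicit.
Unset Printing Implicit Defensive.

Import Order.TTheory GRing.Theory Num.Theory.
Local Open Scope classical_set_scope.
Local Open Scope ring_scope.

(** Put z = circ t, the conjugate of expi t.  In these variables the Toeplitz
    matrix of phi is the Gram matrix of the monomials for the inner product
    [weighted_ip] with weight phi, and the Nth partial sum of the (i, j) entry
    of A is the coefficient of z^j in the kernel K reproducing the coefficient
    of z^i on polynomials of degree < N ([coef_repr_kernel],
    [weighted_ip_repr_kernel]); equivalently, the Nth partial sums with
    i, j < N form the inverse of the N by N corner of the Toeplitz matrix.

    The weight is at least m = inf phi > 0, so K has diagonal coefficient at
    most 1/m; hence the rows of the transition matrix are square summable, and
    the series that define A converge ([repr_kernel_diag_le],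
    [conj_mul_tr_defined_bounded]).

    Far from the corner the inverse of the Toeplitz matrix of phi is close to
    the Toeplitz matrix of 1/phi ([repr_kernel_asymptotics]).  Approximate 1/phi
    uniformly by a trigonometric polynomial z^(-d) Q(z) ([trig_approx]).  For
    i >= d the function z^(i-d) Q is a polynomial q, and once N exceeds its
    degree the difference p = q - K satisfies

      <p, p> = mean (phi q conj(p)) - mean (z^i conj(p)),

    because K reproduces the coefficient p_i, which is also the mean of
    p conj(z^i).  As phi q - z^i is uniformly small and <p, p> dominates m times
    the L^2 norm of p squared, p is small in L^2, and so is each coefficient of
    K - q.  Finally the coefficients of q are close to the entries
    mean (z^i conj(z^j) / phi).  The bound is uniform in j and N, so it passes
    to the limit in N and then along every diagonal. *)

(** * Real and imaginary parts, and continuity of complex-valued functions *)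

Lemma toCxD (R : realType) : {morph @toCx R : x y / x + y}.
Proof. exact: (rmorphD (real_complex R)). Qed.

Lemma toCxM (R : realType) : {morph @toCx R : x y / x * y}.
Proof. exact: (rmorphM (real_complex R)). Qed.

Lemma toCxB (R : realType) : {morph @toCx R : x y / x - y}.
Proof. exact: (rmorphB (real_complex R)). Qed.

Lemma toCx_nat (R : realType) n : toCx (n%:R : R) = n%:R.
Proof. exact: (rmorph_nat (real_complex R)). Qed.

Lemma toCx_sum (R : realType) (I : Type) (r : seq I) (f : I -> R) :
  toCx (\sum_(i <- r) f i) = \sum_(i <- r) toCx (f i).
Proof. exact: (rmorph_sum (real_complex R)). Qed.

Lemma conj_toCx (R : realType) (x : R) : (toCx x)^* = toCx x.
Proof. exact: conjc_real. Qed.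

Lemma ler_toCx (R : realType) (x y : R) : (toCx x <= toCx y) = (x <= y).
Proof. exact: lecR. Qed.

Lemma toCx_Re (R : realType) (z : Cx R) : 0 <= z -> toCx (complex.Re z) = z.
Proof. by move=> /ger0_real; exact: RRe_real. Qed.

Lemma ltr_toCx (R : realType) (x y : R) : (toCx x < toCx y) = (x < y).
Proof. exact: ltcR. Qed.

Lemma normr_toCx (R : realType) (x : R) : `|toCx x| = toCx `|x|.
Proof. by rewrite [LHS]normc_def /= expr0n addr0 sqrtr_sqr. Qed.

Lemma CReD (R : realType) (x y : Cx R) :
  complex.Re (x + y) = complex.Re x + complex.Re y.
Proof. by case: x y => [a b] [c d]. Qed.

Lemma CImD (R : realType) (x y : Cx R) :
  complex.Im (x + y) = complex.Im x + complex.Im y.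
Proof. by case: x y => [a b] [c d]. Qed.

Lemma CReM (R : realType) (x y : Cx R) :
  complex.Re (x * y) =
  complex.Re x * complex.Re y - complex.Im x * complex.Im y.
Proof. by case: x y => [a b] [c d]. Qed.

Lemma CImM (R : realType) (x y : Cx R) :
  complex.Im (x * y) =
  complex.Re x * complex.Im y + complex.Im x * complex.Re y.
Proof. by case: x y => [a b] [c d]. Qed.

Lemma CRe_conj (R : realType) (x : Cx R) : complex.Re (x^*) = complex.Re x.
Proof. by case: x. Qed.

Lemma CIm_conj (R : realType) (x : Cx R) : complex.Im (x^*) = - complex.Im x.
Proof. by case: x. Qed.

Lemma Cx_eq (R : realType) (x y : Cx R) :
  complex.Re x = complex.Re y -> complex.Im x = complex.Im y -> x = y.
Proof. by case: x y => [a b] [c d] /= -> ->. Qed.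

Lemma ler_Re_norm (R : realType) (x : Cx R) : toCx `|complex.Re x| <= `|x|.
Proof. exact: normc_ge_Re. Qed.

Lemma ler_Im_norm (R : realType) (x : Cx R) : toCx `|complex.Im x| <= `|x|.
Proof.
have := ler_Re_norm (x * 'i); rewrite normrM normCi mulr1 CReM /=.
by rewrite mulr0 mulr1 sub0r normrN.
Qed.

Lemma Cx_rect (R : realType) (x : Cx R) :
  x = toCx (complex.Re x) + 'i * toCx (complex.Im x).
Proof. exact: complexE. Qed.

Lemma near_dist_Cx (R : realType) (z e : Cx R) : 0 < e ->
  \forall w \near z, `|z - w| < e.
Proof.
move=> e0.
have H : Filter (nbhs z) by exact: nbhs_filter.
apply: (@cvgr_dist_lt (Cx R) (Cx R) (Cx R) (nbhs z) H id z _ e e0).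
exact: cvg_id.
Qed.

Lemma continuous_Re (R : realType) : continuous (fun z : Cx R => complex.Re z).
Proof.
move=> z; apply/(@cvgrPdist_lt _ _ _ (nbhs z) (nbhs_filter z)) => e e0.
rewrite -ltr_toCx in e0.
apply: (@filterS _ _ (nbhs_filter z) _ _ _ (near_dist_Cx z e0)) => w zw.
rewrite -ltr_toCx.
apply: le_lt_trans zw.
by have := ler_Re_norm (z - w); case: (z) (w) => [? ?] [? ?].
Qed.

Lemma continuous_Im (R : realType) : continuous (fun z : Cx R => complex.Im z).
Proof.
move=> z; apply/(@cvgrPdist_lt _ _ _ (nbhs z) (nbhs_filter z)) => e e0.
rewrite -ltr_toCx in e0.
apply: (@filterS _ _ (nbhs_filter z) _ _ _ (near_dist_Cx z e0)) => w zw.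
rewrite -ltr_toCx.
apply: le_lt_trans zw.
by have := ler_Im_norm (z - w); case: (z) (w) => [? ?] [? ?].
Qed.

Lemma continuous_toCx (R : realType) : continuous (@toCx R).
Proof.
move=> x; apply/cvgrPdist_lt => e e0.
have e0' : 0 < complex.Re e by rewrite -ltr_toCx toCx_Re// ltW.
near=> y.
have xy : `|x - y| < complex.Re e by near: y; apply: cvgr_dist_lt e0'.
rewrite -ltr_toCx toCx_Re ?ltW// in xy.
by rewrite -normr_toCx in xy; move: xy; rewrite /toCx rmorphB.
Unshelve. all: by end_near. Qed.

Lemma continuous_Cconj (R : realType) : continuous (fun z : Cx R => z^*).
Proof.
move=> z; apply/(@cvgrPdist_lt _ _ _ (nbhs z) (nbhs_filter z)) => e e0.
by apply: (@filterS _ _ (nbhs_filter z) _ _ _ (near_dist_Cx z e0)) => w;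
  rewrite -rmorphB norm_conjC.
Qed.

Lemma continuous_mulf (R : realType) (f g : R -> Cx R) :
  continuous f -> continuous g -> continuous (fun t => f t * g t).
Proof. by move=> cf cg t; apply: cvgM; [exact: cf|exact: cg]. Qed.

Lemma continuous_addf (R : realType) (f g : R -> Cx R) :
  continuous f -> continuous g -> continuous (fun t => f t + g t).
Proof. by move=> cf cg t; apply: cvgD; [exact: cf|exact: cg]. Qed.

Lemma continuous_conjf (R : realType) (f : R -> Cx R) :
  continuous f -> continuous (fun t => (f t)^*).
Proof.
by move=> cf t; apply: continuous_comp; [exact: cf|exact: continuous_Cconj].
Qed.

Lemma continuous_toCxf (R : realType) (f : R -> R) :
  continuous f -> continuous (fun t => toCx (f t)).
Proof.
by move=> cf t; apply: continuous_comp; [exact: cf|exact: continuous_toCx].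
Qed.

Lemma continuous_expi (R : realType) : continuous (@expi R).
Proof.
have -> : @expi R = fun t => toCx (cos t) + 'i * toCx (sin t).
  by apply/funext => t; rewrite [LHS]Cx_rect.
apply: continuous_addf; first exact/continuous_toCxf/continuous_cos.
apply: continuous_mulf; first by move=> t; exact: cvg_cst.
exact/continuous_toCxf/continuous_sin.
Qed.

(** The conjugate, because the Toeplitz inner product of z^i and z^j is the
    Fourier coefficient of index i - j, the mean of the symbol times
    expi (- (i - j) t). *)
Definition circ (R : realType) (t : R) : Cx R := (expi t)^*.

(** * The normalized integral over a period *)

Definition mean (R : realType) (f : R -> Cx R) : Cx R :=
  toCx (1 / (2 * pi)) * Cintegral `[0, 2 * pi] f.

Lemma twopi_gt0 (R : realType) : 0 < 2 * pi :> R.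
Proof. by rewrite mulr_gt0// pi_gt0. Qed.

Lemma Rintegrable_period (R : realType) (f : R -> R) : continuous f ->
  (@lebesgue_measure R).-integrable `[0, 2 * pi] (EFin \o f).
Proof.
move=> cf; apply: continuous_compact_integrable.
  exact: segment_compact.
exact: continuous_subspaceT.
Qed.

Lemma continuous_Ref (R : realType) (f : R -> Cx R) : continuous f ->
  continuous (fun t => complex.Re (f t)).
Proof.
by move=> cf t; apply: continuous_comp; [exact: cf|exact: continuous_Re].
Qed.

Lemma continuous_Imf (R : realType) (f : R -> Cx R) : continuous f ->
  continuous (fun t => complex.Im (f t)).
Proof.
by move=> cf t; apply: continuous_comp; [exact: cf|exact: continuous_Im].
Qed.


Lemma continuous_cstf (R : realType) (c : Cx R) : continuous (fun _ : R => c).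
Proof. by move=> t; exact: cvg_cst. Qed.

Lemma continuous_oppf (R : realType) (f : R -> Cx R) :
  continuous f -> continuous (fun t => - f t).
Proof. by move=> cf t; apply: cvgN; exact: cf. Qed.

Lemma continuous_expf (R : realType) (f : R -> Cx R) n :
  continuous f -> continuous (fun t => f t ^+ n).
Proof.
move=> cf; elim: n => [|n IHn].
  by under eq_fun do rewrite expr0; exact: continuous_cstf.
by under eq_fun do rewrite exprS; exact: continuous_mulf.
Qed.

Lemma continuous_circ (R : realType) : continuous (@circ R).
Proof. exact/continuous_conjf/continuous_expi. Qed.

Lemma continuous_sumf (R : realType) (I : Type) (r : seq I)
    (f : I -> R -> Cx R) : (forall i, continuous (f i)) ->
  continuous (fun t => \sum_(i <- r) f i t).
Proof.
move=> cf; elim: r => [|i r IHr].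
  have -> : (fun t => \sum_(j <- [::]) f j t) = fun=> 0.
    by apply/funext => t; rewrite big_nil.
  exact: continuous_cstf.
have -> : (fun t => \sum_(j <- i :: r) f j t) =
  (fun t => f i t + \sum_(j <- r) f j t).
  by apply/funext => t; rewrite big_cons.
by apply: continuous_addf; [exact: cf|exact: IHr].
Qed.

Lemma continuous_horner_circ (R : realType) (p : {poly Cx R}) :
  continuous (fun t : R => p.[circ t]).
Proof.
have -> : (fun t => p.[circ t]) = fun t => \sum_(i < size p) p`_i * circ t ^+ i.
  by apply/funext => t; rewrite horner_coef.
apply: continuous_sumf => i.
apply: continuous_mulf; first exact: continuous_cstf.
exact/continuous_expf/continuous_circ.
Qed.

(* Goals are matched syntactically, since comparing two distinct functions into
   [Cx R] by unification unfolds the whole topology of the field. *)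
Ltac cont_hyp := match goal with
  | H : ?T |- ?G => constr_eq T G; exact: H
  | H : forall i, continuous (?f i) |- continuous (?g _) =>
      constr_eq f g; exact: H
  end.

(* The values at two formally different points are the same term only when the
   argument does not occur. *)
Ltac cont_cst := match goal with
  | R : realType |- continuous ?f =>
      let a := eval cbv beta in (f (0 : R)) in
      let b := eval cbv beta in (f (1 : R)) in
      constr_eq a b; exact: cst_continuous
  end.

Ltac cont := first [cont_hyp | cont_cst | lazymatch goal with
  | |- continuous (@circ _) => exact: continuous_circ
  | |- continuous (fun t => @?f t * @?g t) =>
      refine (@continuous_mulf _ f g _ _); cont
  | |- continuous (fun t => @?f t + @?g t) =>
      refine (@continuous_addf _ f g _ _); cont
  | |- continuous (fun t => - @?f t) => refine (@continuous_oppf _ f _); cont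
  | |- continuous (fun t => (@?f t)^*) => refine (@continuous_conjf _ f _); cont
  | |- continuous (fun t => @?f t ^+ ?n) =>
      refine (@continuous_expf _ f n _); cont
  | |- continuous (fun t => toCx (@?f t)) =>
      refine (@continuous_toCxf _ f _); cont
  | |- continuous (fun t => complex.Re (@?f t)) =>
      refine (@continuous_Ref _ f _); cont
  | |- continuous (fun t => complex.Im (@?f t)) =>
      refine (@continuous_Imf _ f _); cont
  | |- continuous (fun t => (?p).[circ t]) => exact: continuous_horner_circ
  | |- continuous (fun t => ?f t) => change (continuous f); cont
  | |- continuous (fun t => \sum_(i <- ?r) @?f t i) =>
      refine (@continuous_sumf _ _ r (fun i t => f t i) _);
      move=> ? /=; cont
  | |- _ => idtac
  end].

Lemma eq_mean (R : realType) (f g : R -> Cx R) : f =1 g -> mean f = mean g.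
Proof. by move=> /funext ->. Qed.

Lemma Re_mean (R : realType) (f : R -> Cx R) : complex.Re (mean f) =
  1 / (2 * pi) * Rintegral lebesgue_measure `[0, 2 * pi]
    (fun t => complex.Re (f t)).
Proof. by rewrite CReM /= mul0r subr0. Qed.

Lemma Im_mean (R : realType) (f : R -> Cx R) : complex.Im (mean f) =
  1 / (2 * pi) * Rintegral lebesgue_measure `[0, 2 * pi]
    (fun t => complex.Im (f t)).
Proof. by rewrite CImM /= mul0r addr0. Qed.

Lemma Rintegral_lin (R : realType) (a b : R) (g h : R -> R) :
  continuous g -> continuous h ->
  Rintegral lebesgue_measure `[0, 2 * pi] (fun t => a * g t + b * h t) =
  a * Rintegral lebesgue_measure `[0, 2 * pi] g +
  b * Rintegral lebesgue_measure `[0, 2 * pi] h.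
Proof.
move=> cg ch.
have cM d (k : R -> R) : continuous k -> continuous (fun t => d * k t).
  by move=> ck t; apply: cvgM; [exact: cvg_cst|exact: ck].
rewrite RintegralD//; last 2 first.
- by apply: Rintegrable_period; exact: cM.
- by apply: Rintegrable_period; exact: cM.
by rewrite !RintegralZl//; exact: Rintegrable_period.
Qed.

Lemma meanD (R : realType) (f g : R -> Cx R) : continuous f -> continuous g ->
  mean (fun t => f t + g t) = mean f + mean g.
Proof.
move=> cf cg; apply: Cx_eq.
  rewrite CReD !Re_mean -mulrDr; congr (_ * _).
  under eq_Rintegral do rewrite CReD -[X in X + _]mul1r -[X in _ + X]mul1r.
  by rewrite Rintegral_lin; [rewrite !mul1r|cont|cont].
rewrite CImD !Im_mean -mulrDr; congr (_ * _).
under eq_Rintegral do rewrite CImD -[X in X + _]mul1r -[X in _ + X]mul1r.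
by rewrite Rintegral_lin; [rewrite !mul1r|cont|cont].
Qed.

Lemma meanZ (R : realType) (c : Cx R) (f : R -> Cx R) : continuous f ->
  mean (fun t => c * f t) = c * mean f.
Proof.
move=> cf; apply: Cx_eq.
  rewrite CReM !Re_mean Im_mean.
  under eq_Rintegral do rewrite CReM -mulNr.
  by rewrite Rintegral_lin; [ring|cont|cont].
rewrite CImM !Im_mean Re_mean.
under eq_Rintegral do rewrite CImM.
by rewrite Rintegral_lin; [ring|cont|cont].
Qed.

Lemma meanB (R : realType) (f g : R -> Cx R) : continuous f -> continuous g ->
  mean (fun t => f t - g t) = mean f - mean g.
Proof.
move=> cf cg; rewrite -[- mean g]mulN1r -meanZ// -meanD; [|cont|cont].
by apply: eq_mean => t; rewrite mulN1r.
Qed.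

Lemma mean0 (R : realType) : mean (fun _ : R => 0) = 0.
Proof.
rewrite (@eq_mean _ _ (fun=> 0 * 0)); last by move=> t; rewrite mul0r.
by rewrite meanZ ?mul0r//; cont.
Qed.

Lemma mean_sum (R : realType) (I : Type) (r : seq I) (f : I -> R -> Cx R) :
  (forall i, continuous (f i)) ->
  mean (fun t => \sum_(i <- r) f i t) = \sum_(i <- r) mean (f i).
Proof.
move=> cf; elim: r => [|i r IHr].
  by under eq_mean do rewrite big_nil; rewrite mean0 big_nil.
under eq_mean do rewrite big_cons.
by rewrite meanD ?IHr ?big_cons//; exact: continuous_sumf.
Qed.

Lemma mean_conj (R : realType) (f : R -> Cx R) : continuous f ->
  mean (fun t => (f t)^*) = (mean f)^*.
Proof.
move=> cf; apply: Cx_eq; rewrite (CRe_conj, CIm_conj) !(Re_mean, Im_mean).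
  by under eq_Rintegral do rewrite CRe_conj.
rewrite -mulrN; congr (_ * _).
under eq_Rintegral do rewrite CIm_conj -[- _]addr0 -mulN1r -[X in _ + X](mul0r 0).
by rewrite (@Rintegral_lin _ (-1) 0 _ (fun=> 0)); [ring|cont|exact: cst_continuous].
Qed.

Lemma Re_mean_le (R : realType) (f g : R -> Cx R) :
  continuous f -> continuous g ->
  (forall t, t \in `[0, 2 * pi] -> complex.Re (f t) <= complex.Re (g t)) ->
  complex.Re (mean f) <= complex.Re (mean g).
Proof.
move=> cf cg fg; rewrite !Re_mean ler_wpM2l//.
  by rewrite divr_ge0// ltW// twopi_gt0.
by apply: le_Rintegral => //; apply: Rintegrable_period; cont.
Qed.

Lemma Im_mean_eq0 (R : realType) (f : R -> Cx R) : continuous f ->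
  (forall t, t \in `[0, 2 * pi] -> complex.Im (f t) = 0) ->
  complex.Im (mean f) = 0.
Proof.
move=> cf f0; rewrite Im_mean.
rewrite (@eq_Rintegral _ _ _ _ _ (fun=> 0)) ?Rintegral_cst ?mul0r ?mulr0//.
by move=> t; rewrite inE => /f0.
Qed.

Lemma mean_ge0 (R : realType) (f : R -> Cx R) : continuous f ->
  (forall t, t \in `[0, 2 * pi] -> 0 <= f t) -> 0 <= mean f.
Proof.
move=> cf f0; rewrite [_ <= _]lecE Im_mean_eq0//; last first.
  by move=> t /f0; exact: ger0_Im.
rewrite eqxx /=; have := @Re_mean_le R (fun=> 0) f; rewrite mean0.
apply; [by cont|by []|]; move=> t /f0; by rewrite [_ <= _]lecE => /andP[].
Qed.

Lemma mean_le (R : realType) (f g : R -> Cx R) : continuous f -> continuous g ->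
  (forall t, t \in `[0, 2 * pi] -> f t <= g t) -> mean f <= mean g.
Proof.
move=> cf cg fg; rewrite -subr_ge0 -meanB; [|by []|by []].
apply: mean_ge0; first by cont.
by move=> t /fg; rewrite subr_ge0.
Qed.

(** Rotating the integral onto the positive axis reduces the bound to the
    monotonicity of the integral of real parts. *)
Lemma norm_mean_le (R : realType) (f g : R -> Cx R) :
  continuous f -> continuous g ->
  (forall t, t \in `[0, 2 * pi] -> `|f t| <= g t) -> `|mean f| <= mean g.
Proof.
move=> cf cg fg.
have g0 : 0 <= mean g.
  by apply: mean_ge0 => [//|t /fg]; apply: le_trans.
have [->|I0] := eqVneq (mean f) 0; first by rewrite normr0.
pose c : Cx R := (mean f)^* / `|mean f|.
have c1 : `|c| = 1.
  by rewrite normf_div normr_id norm_conjC divff// normr_eq0.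
have cI : c * mean f = `|mean f|.
  rewrite /c mulrAC [_^* * _]mulrC -normCK expr2 mulfK//.
  by rewrite normr_eq0.
rewrite -cI -(meanZ c cf) -[leLHS]toCx_Re; last by rewrite (meanZ c cf) cI.
rewrite -[leRHS]toCx_Re// ler_toCx; apply: Re_mean_le; [by cont|by []|]; move=> t /fg fgt.
have : `|c * f t| <= g t by rewrite normrM c1 mul1r.
move=> /(le_trans (ler_Re_norm _)).
rewrite -[leRHS]toCx_Re; last exact: le_trans fgt.
by rewrite ler_toCx; apply: le_trans; exact: ler_norm.
Qed.

(** * Orthogonality of the characters *)

Lemma expiD (R : realType) (a b : R) : expi (a + b) = expi a * expi b.
Proof.
apply: Cx_eq; rewrite (CReM, CImM) /= ?cosD ?sinD//.
by rewrite addrC [X in X + _]mulrC.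
Qed.

Lemma expiN (R : realType) (a : R) : expi (- a) = (expi a)^*.
Proof. by apply: Cx_eq; rewrite (CRe_conj, CIm_conj) /= ?cosN ?sinN. Qed.

Lemma expi0 (R : realType) : expi (0 : R) = 1.
Proof. by apply: Cx_eq; rewrite /= ?cos0 ?sin0. Qed.

Lemma expiX (R : realType) (a : R) n : expi (n%:R * a) = expi a ^+ n.
Proof.
elim: n => [|n IHn]; first by rewrite mul0r expi0.
by rewrite -natr1 mulrDl mul1r expiD IHn exprSr.
Qed.

Lemma norm_expi (R : realType) (t : R) : `|expi t| = 1.
Proof. by rewrite [LHS]normc_def /= cos2Dsin2 sqrtr1. Qed.

Lemma norm_circ (R : realType) (t : R) : `|circ t| = 1.
Proof. by rewrite norm_conjC norm_expi. Qed.

Lemma circ_conj (R : realType) (t : R) : circ t * (circ t)^* = 1.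
Proof. by rewrite -normCK norm_circ expr1n. Qed.

Lemma expi_circ (R : realType) (t : R) (m n : nat) :
  expi (- ((m%:Z - n%:Z)%:~R * t)) = circ t ^+ m * (circ t)^* ^+ n.
Proof.
rewrite rmorphB /= mulrBl opprB expiD expiN -!pmulrn !expiX mulrC.
by rewrite rmorphXn /circ conjCK.
Qed.

Lemma toeplitz_mean (R : realType) (psi : Cx R -> Cx R) m n :
  toeplitz psi m n =
  mean (fun t => psi (expi t) * (circ t ^+ m * (circ t)^* ^+ n)).
Proof. by apply: eq_mean => t; rewrite expi_circ. Qed.

Lemma mean1 (R : realType) : mean (fun _ : R => 1) = 1.
Proof.
apply: Cx_eq; rewrite (Re_mean, Im_mean) Rintegral_cst//= ?mul0r ?mulr0//.
rewrite lebesgue_measure_itv/= lte_fin twopi_gt0 -EFinB /= subr0 mul1r.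
by rewrite mul1r mulVf// gt_eqF// twopi_gt0.
Qed.

Lemma Rintegral_FTC (R : realType) (f F : R -> R) : continuous f ->
  (forall x : R, is_derive x 1 F (f x)) ->
  Rintegral lebesgue_measure `[0, 2 * pi] f = F (2 * pi) - F 0.
Proof.
move=> cf dF; have dF' (x : R) : derivable F x 1 by have [] := dF x.
have cF : continuous F.
  by move=> x; apply/differentiable_continuous/derivable1_diffP.
rewrite /Rintegral (@continuous_FTC2 _ _ F)//.
- exact: twopi_gt0.
- exact: continuous_subspaceT.
- split.
  + by move=> x _; exact: dF'.
  + by apply: cvg_at_right_filter; exact: cF.
  + by apply: cvg_at_left_filter; exact: cF.
- by move=> x _; rewrite derive1E; have [] := dF x.
Qed.

Lemma mean_circX (R : realType) k : mean (fun t : R => circ t ^+ k.+1) = 0.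
Proof.
have k0 : k.+1%:R != 0 :> R by rewrite pnatr_eq0.
have E t : circ t ^+ k.+1 = (expi (k.+1%:R * t : R))^*.
  by rewrite expiX /circ rmorphXn.
have P : expi (k.+1%:R * (2 * pi) : R) = 1.
  rewrite expiX (_ : expi _ = 1) ?expr1n// mulr_natl.
  by apply: Cx_eq; rewrite /= ?cos2pi ?sin2pi.
have cpi : cos (k.+1%:R * (2 * pi)) = 1 :> R by rewrite -[LHS]/(complex.Re (expi _)) P.
have spi : sin (k.+1%:R * (2 * pi)) = 0 :> R by rewrite -[LHS]/(complex.Im (expi _)) P.
have cl : continuous (fun t : R => k.+1%:R * t) by exact: mulrl_continuous.
apply: Cx_eq; rewrite (Re_mean, Im_mean).
- rewrite (_ : Rintegral _ _ _ = sin (k.+1%:R * (2 * pi)) / k.+1%:R -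
    sin (k.+1%:R * 0) / k.+1%:R).
    by rewrite mulr0 sin0 spi !mul0r subrr mulr0.
  under eq_Rintegral do rewrite E /=.
  apply: (@Rintegral_FTC _ _ (fun t => sin (k.+1%:R * t) / k.+1%:R)).
    by move=> t; apply: continuous_comp; [exact: cl|exact: continuous_cos].
  by move=> x; apply: is_derive_eq; rewrite /GRing.scale /=; field.
- rewrite (_ : Rintegral _ _ _ = cos (k.+1%:R * (2 * pi)) / k.+1%:R -
    cos (k.+1%:R * 0) / k.+1%:R).
    by rewrite mulr0 cos0 cpi subrr mulr0.
  under eq_Rintegral do rewrite E /=.
  apply: (@Rintegral_FTC _ _ (fun t => cos (k.+1%:R * t) / k.+1%:R)).
    move=> t; apply: cvgN; apply: continuous_comp; first exact: cl.
    exact: continuous_sin.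
  by move=> x; apply: is_derive_eq; rewrite /GRing.scale /=; field.
Qed.

Lemma mean_circ_orth (R : realType) (m n : nat) :
  mean (fun t : R => circ t ^+ m * (circ t)^* ^+ n) = (m == n)%:R.
Proof.
have lt a b : (a < b)%N -> mean (fun t : R => circ t ^+ b * (circ t)^* ^+ a) = 0.
  move=> ab; rewrite -(mean_circX R (b - a).-1); apply: eq_mean => t.
  rewrite prednK ?subn_gt0// -[in LHS](subnK (ltnW ab)) exprD -mulrA -exprMn.
  by rewrite circ_conj expr1n mulr1.
have [mn|nm|->] := ltngtP m n.
- rewrite -(conjCK (mean _)) -mean_conj; last by cont.
  rewrite (@eq_mean _ _ (fun t => circ t ^+ n * (circ t)^* ^+ m)).
    by rewrite lt// conjC0.
  by move=> t; rewrite rmorphM mulrC; congr (_ * _);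
    rewrite rmorphXn; congr (_ ^+ _); exact: conjCK.
- by rewrite lt.
- rewrite -mean1; apply: eq_mean => t.
  by rewrite -exprMn circ_conj expr1n.
Qed.

(** * The weighted inner product and its reproducing kernel *)

Definition weighted_ip (R : realType) (w : R -> R) (p q : {poly Cx R}) : Cx R :=
  mean (fun t => toCx (w t) * (p.[circ t] * (q.[circ t])^*)).

Lemma mean_coef (R : realType) (p : {poly Cx R}) j :
  mean (fun t => p.[circ t] * (circ t)^* ^+ j) = p`_j.
Proof.
rewrite (@eq_mean _ _ (fun t => \sum_(i < size p)
  p`_i * (circ t ^+ i * (circ t)^* ^+ j))); last first.
  by move=> t; rewrite horner_coef mulr_suml; apply: eq_bigr => i _; rewrite mulrA.
rewrite mean_sum; last by move=> i; cont.
under eq_bigr do [rewrite meanZ; [|cont]]; under eq_bigr do rewrite mean_circ_orth.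
have [jp|jp] := ltnP j (size p).
  rewrite (bigD1 (Ordinal jp))//= eqxx mulr1 big1 ?addr0// => i ij.
  by rewrite (_ : (i == j :> nat) = false) ?mulr0//; apply/negbTE; exact: ij.
rewrite nth_default// big1// => i _.
by rewrite ltn_eqF ?mulr0// (leq_trans _ jp).
Qed.

Lemma inner_toeplitz (R : realType) (phi : Cx R -> R) (p q : {poly Cx R}) :
  continuous (fun t : R => phi (expi t)) ->
  inner (toeplitz (fun z => toCx (phi z))) p q =
  weighted_ip (fun t => phi (expi t)) p q.
Proof.
move=> cphi.
rewrite /weighted_ip (@eq_mean _ _ (fun t => \sum_(i < size p) \sum_(j < size q)
  p`_i * (q`_j)^* * (toCx (phi (expi t)) * (circ t ^+ i * (circ t)^* ^+ j))));
  last first.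
  move=> t; rewrite !horner_coef mulr_suml mulr_sumr.
  apply: eq_bigr => i _; rewrite rmorph_sum /= !mulr_sumr.
  apply: eq_bigr => j _; rewrite rmorphM rmorphXn /=; ring.
rewrite mean_sum; last by move=> i; cont.
apply: eq_bigr => i _; rewrite mean_sum; last by move=> j; cont.
by apply: eq_bigr => j _; rewrite meanZ ?toeplitz_mean//; cont.
Qed.

Lemma weighted_ipDl (R : realType) (w : R -> R) (p p' q : {poly Cx R}) :
  continuous w ->
  weighted_ip w (p + p') q = weighted_ip w p q + weighted_ip w p' q.
Proof.
move=> cw; rewrite /weighted_ip -meanD; [|cont|cont].
by apply: eq_mean => t; rewrite hornerD; ring.
Qed.

Lemma weighted_ipZl (R : realType) (w : R -> R) c (p q : {poly Cx R}) :
  continuous w -> weighted_ip w (c *: p) q = c * weighted_ip w p q.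
Proof.
move=> cw; rewrite /weighted_ip -meanZ; last by cont.
by apply: eq_mean => t; rewrite hornerZ; ring.
Qed.

Lemma weighted_ipC (R : realType) (w : R -> R) (p q : {poly Cx R}) :
  continuous w -> weighted_ip w q p = (weighted_ip w p q)^*.
Proof.
move=> cw; rewrite /weighted_ip -mean_conj; last by cont.
by apply: eq_mean => t; rewrite !rmorphM /= conjCK conj_toCx; ring.
Qed.

Lemma weighted_ip_suml (R : realType) (w : R -> R) (I : Type) (r : seq I) c
    (P : I -> {poly Cx R}) q : continuous w ->
  weighted_ip w (\sum_(k <- r) c k *: P k) q =
  \sum_(k <- r) c k * weighted_ip w (P k) q.
Proof.
move=> cw; elim: r => [|k r IHr]; last first.
  by rewrite !big_cons weighted_ipDl// weighted_ipZl// IHr.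
by rewrite !big_nil -(scale0r (0 : {poly Cx R})) weighted_ipZl// mul0r.
Qed.

(** The degrees are consecutive, so subtracting a multiple of the last
    polynomial lowers the degree. *)
Lemma poly_expansion (R : realType) (P : nat -> {poly Cx R}) :
  (forall n, size (P n) = n.+1) ->
  forall N (p : {poly Cx R}), (size p <= N)%N ->
  exists c : nat -> Cx R, p = \sum_(0 <= k < N) c k *: P k.
Proof.
move=> sP; elim=> [|N IHN] p sp.
  exists (fun=> 0); rewrite big_nil; apply/eqP.
  by rewrite -size_poly_eq0 -leqn0.
have PN : (P N)`_N != 0.
  by have := lead_coef_eq0 (P N); rewrite /lead_coef sP /= => ->;
    rewrite -size_poly_eq0 sP.
have [|c cE] := IHN (p - (p`_N / (P N)`_N) *: P N).
  apply/leq_sizeP => j; rewrite leq_eqVlt => /predU1P[<-|Nj].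
    by rewrite coefB coefZ divfK// subrr.
  rewrite coefB coefZ [p`_j]nth_default ?[(P N)`_j]nth_default ?sP//.
    by rewrite mulr0 subr0.
  exact: leq_trans Nj.
exists (fun k => if k == N then p`_N / (P N)`_N else c k).
rewrite big_nat_recr//= eqxx -(eq_big_nat _ _ (F1 := fun k => c k *: P k)).
  by rewrite -cE subrK.
by move=> k /andP[_ kN]; rewrite ltn_eqF.
Qed.

(** The coefficient of conj(w)^i in the Christoffel-Darboux kernel
    \sum_k P_k(z) conj(P_k(w)).  On polynomials of degree less than N it
    represents the functional that extracts the ith coefficient. *)
Definition repr_kernel (R : realType) (P : nat -> {poly Cx R}) N i :
    {poly Cx R} :=
  \sum_(0 <= k < N) ((P k)`_i)^* *: P k.

Lemma weighted_ip_repr_kernel (R : realType) (w : R -> R) (P : nat -> {poly Cx R}) :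
  continuous w -> (forall n, size (P n) = n.+1) ->
  (forall n m, weighted_ip w (P n) (P m) = (n == m)%:R) ->
  forall N i (p : {poly Cx R}), (size p <= N)%N ->
  weighted_ip w p (repr_kernel P N i) = p`_i.
Proof.
move=> cw sP oP N i p sp.
have kE q : weighted_ip w q (repr_kernel P N i) =
    \sum_(0 <= k < N) (P k)`_i * weighted_ip w q (P k).
  rewrite weighted_ipC// weighted_ip_suml// rmorph_sum /=.
  by apply: eq_bigr => k _; rewrite rmorphM /= conjCK -weighted_ipC.
have [c ->] := poly_expansion sP sp.
rewrite weighted_ip_suml// coef_sum big_seq [RHS]big_seq.
apply: eq_bigr => l; rewrite mem_index_iota => /andP[_ lN].
rewrite coefZ kE (bigD1_seq l) ?mem_index_iota ?iota_uniq//= oP eqxx mulr1.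
by rewrite big1 ?addr0// => k kl; rewrite oP eq_sym (negbTE kl) mulr0.
Qed.

(** The two sums differ by the terms of index below max (i, j), which vanish
    because the transition matrix is triangular. *)
Lemma coef_repr_kernel (R : realType) (P : nat -> {poly Cx R}) N i j :
  (forall n, size (P n) = n.+1) ->
  (repr_kernel P N i)`_j = conj_mul_tr_partial (transition_matrix P) i j N.
Proof.
move=> sP; rewrite coef_sum /conj_mul_tr_partial.
under eq_bigr do rewrite coefZ.
rewrite /transition_matrix.
have z k : (k < maxn i j)%N -> ((P k)`_i)^* * (P k)`_j = 0.
  rewrite leq_max => /orP[ki|kj].
    by rewrite [(P k)`_i]nth_default ?sP// conjC0 mul0r.
  by rewrite [(P k)`_j]nth_default ?sP// mulr0.
have [mN|Nm] := leqP (maxn i j) N.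
  by rewrite (big_cat_nat _ mN)//= big_nat big1 ?add0r.
rewrite [RHS]big_geq 1?ltnW// big_nat big1// => k /andP[_ kN].
by apply: z; exact: ltn_trans Nm.
Qed.

(** * Uniform approximation by trigonometric polynomials *)

(** Korovkin's form of uniform continuity, with the squared chord in place of a
    modulus.  Locally in (s, t) a large C works: where the chord vanishes, u s
    and u t agree, and elsewhere the chord is bounded below.  Compactness of
    the square makes C uniform.  The chord, unlike |s - t|, also identifies the
    two ends of the period. *)
Lemma circle_modulus (R : realType) (u : R -> R) (e : R) :
  continuous u -> (forall s t : R, expi s = expi t -> u s = u t) -> 0 < e ->
  exists2 C : R, 0 <= C & forall s t, s \in `[0, 2 * pi] -> t \in `[0, 2 * pi] ->
    toCx `|u s - u t| <= toCx e + toCx C * `|circ s - circ t| ^+ 2.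
Proof.
move=> cu uE e0.
pose dist2 (p : R * R) := (cos p.1 - cos p.2) ^+ 2 + (sin p.1 - sin p.2) ^+ 2.
have dist2E s t : `|circ s - circ t| ^+ 2 = toCx (dist2 (s, t)).
  by rewrite /circ -rmorphB norm_conjC -[LHS]add_Re2_Im2.
pose osc (p : R * R) := `|u p.1 - u p.2|.
have c1 (f : R -> R) : continuous f -> continuous (fun p : R * R => f p.1 - f p.2).
  move=> cf p; apply: cvgB.
    by apply: (@continuous_comp _ _ _ fst f); [exact: cvg_fst|exact: cf].
  by apply: (@continuous_comp _ _ _ snd f); [exact: cvg_snd|exact: cf].
have cdist : continuous dist2.
  move=> p; apply: cvgD; apply: cvgM; apply: c1;
    (exact: continuous_cos || exact: continuous_sin).
have cosc : continuous osc.
  by move=> p; apply: cvg_norm; exact: c1.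
have dist2_ge0 p : 0 <= dist2 p by rewrite addr_ge0 ?sqr_ge0.
have : compact (`[0, 2 * pi] `*` `[0, 2 * pi] : set (R * R)).
  by apply: compact_setX; exact: segment_compact.
move=> /compact_near_coveringP /(_ R +oo
  (fun C p => osc p <= e + C * dist2 p) _) [].
  move=> p _; have [d0|d0] := eqVneq (dist2 p) 0.
    have osc0 : osc p = 0.
      rewrite /osc; have -> : u p.1 = u p.2; last by rewrite subrr normr0.
      move/eqP: d0; rewrite paddr_eq0 ?sqr_ge0// !sqrf_eq0 !subr_eq0.
      by move=> /andP[/eqP pc /eqP ps]; apply: uE; apply: Cx_eq.
    exists ([set q | osc q < e], [set C | 0 < C]) => /=.
      split; last by apply: nbhs_pinfty_gt; rewrite num_real.
      by apply: (cvgr_lt _ (cosc p)); rewrite osc0.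
    move=> [q C] [/= qe C0];
      rewrite (le_trans (ltW qe))// lerDl mulr_ge0// ltW//.
  have dp : 0 < dist2 p by rewrite lt0r d0 dist2_ge0.
  exists ([set q | osc q < osc p + 1 /\ dist2 p / 2 < dist2 q],
          [set C | 2 * (osc p + 1) / dist2 p < C]) => /=.
    split; last by apply: nbhs_pinfty_gt; rewrite num_real.
    apply: filterI.
      by apply: (cvgr_lt _ (cosc p)); rewrite ltrDl.
    apply: (cvgr_gt _ (cdist p)); lra.
  move=> [q C] [/= [oq dq] HC]; rewrite (le_trans (ltW oq))//.
  have osc1 : 0 < osc p + 1 by rewrite ltr_pwDr// normr_ge0.
  rewrite ltW// (@lt_le_trans _ _ (C * dist2 q))//; last by rewrite lerDr ltW.
  rewrite (_ : osc p + 1 = (2 * (osc p + 1) / dist2 p) * (dist2 p / 2)); last by field.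
  apply: ltr_pM => //; first by rewrite divr_ge0 ?mulr_ge0// ltW//.
  by rewrite divr_ge0// ltW.
move=> C [_ HC]; exists (`|C| + 1); first by rewrite addr_ge0.
move=> s t sI tI.
have C1 : C < `|C| + 1 by rewrite (le_lt_trans (ler_norm _))// ltrDl.
rewrite dist2E -toCxM -toCxD ler_toCx.
exact: (HC _ C1 (s, t)).
Qed.

(** Expand the square; orthogonality keeps the n diagonal terms, each
    equal to 1. *)
Lemma mean_dirichlet_sq (R : realType) (s : R) n :
  mean (fun t => `|\sum_(j < n) (circ s * (circ t)^*) ^+ j| ^+ 2) = n%:R.
Proof.
rewrite (@eq_mean _ _ (fun t => \sum_(j < n) \sum_(l < n)
  (circ s ^+ j * (circ s)^* ^+ l) * (circ t ^+ l * (circ t)^* ^+ j))).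
  rewrite mean_sum; last by move=> i; cont.
  under eq_bigr => j _.
    rewrite mean_sum; last by move=> i; cont.
    under eq_bigr => l _.
      rewrite meanZ; last by cont.
      rewrite mean_circ_orth; over.
    rewrite (bigD1 j)//= eqxx mulr1 big1 ?addr0.
      rewrite -exprMn circ_conj expr1n; over.
    move=> l lj; rewrite (_ : (l == j :> nat) = false) ?mulr0//.
    by apply/negbTE; exact: lj.
  by rewrite sumr_const card_ord.
move=> t; rewrite normCK rmorph_sum /= mulr_suml; apply: eq_bigr => j _.
rewrite mulr_sumr; apply: eq_bigr => l _.
by rewrite rmorphXn rmorphM /= conjCK !exprMn; ring.
Qed.

(** The chord is |x - 1| with x = circ s * conj (circ t), so the geometric sum
    telescopes to |x^n - 1| <= 2. *)
Lemma dirichlet_dist_le (R : realType) (s t : R) n :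
  `|\sum_(j < n) (circ s * (circ t)^*) ^+ j| ^+ 2 * `|circ s - circ t| ^+ 2 <= 4.
Proof.
set x := circ s * _.
have x1 : `|x| = 1 by rewrite normrM (norm_conjC (circ t)) !norm_circ mul1r.
have -> : `|circ s - circ t| = `|x - 1|.
  rewrite -[LHS]mulr1 -[X in _ * X](norm_circ t) -(norm_conjC (circ t)) -normrM mulrBl.
  by rewrite circ_conj.
rewrite -exprMn -normrM mulrC -subrX1.
have le2 : `|x ^+ n - 1| <= 2.
  by rewrite (le_trans (ler_normB _ _))// normrX x1 expr1n normr1.
rewrite (_ : 4 = 2 ^+ 2); last by rewrite -natrX.
by rewrite lerXn2r// nnegrE.
Qed.

(** At circ s, Q is circ^n times the convolution of u with the Fejer kernel, the
    squared Dirichlet sum F divided by n.  By [circle_modulus] the error at s is at most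
    the mean over t of (e / 2 + C |circ s - circ t|^2) F / n; the first part
    contributes e / 2 since F / n has mean 1, and the second at most 4 C / n by
    [dirichlet_dist_le]. *)
Lemma trig_approx (R : realType) (u : R -> R) (e : R) :
  continuous u -> (forall s t : R, expi s = expi t -> u s = u t) -> 0 < e ->
  exists d (Q : {poly Cx R}), forall s, s \in `[0, 2 * pi] ->
    `|toCx (u s) * circ s ^+ d - Q.[circ s]| <= toCx e.
Proof.
move=> cu uE e0; have e20 : 0 < e / 2 by rewrite divr_gt0.
have [C C0 HC] := circle_modulus cu uE e20.
(* Large enough for 4 C / n <= e / 2. *)
pose n := (Num.truncn (8 * C / e)).+1.
have nC : toCx (4 * C) / n%:R <= toCx (e / 2).
  rewrite -(toCx_nat R n).
  rewrite ler_pdivrMr -?toCxM ?ler_toCx; last by rewrite ltr_toCx ltr0n.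
  have /ltW : 8 * C / e < n%:R by exact: truncnS_gt.
  rewrite ler_pdivrMr// => H; lra.
have n0 : 0 < n%:R :> Cx R by rewrite ltr0n.
pose D (s t : R) := \sum_(j < n) (circ s * (circ t)^*) ^+ j.
have cD (s : R) : continuous (D s) by rewrite /D; cont.
pose F (s t : R) : Cx R := `|D s t| ^+ 2.
have cF (s : R) : continuous (F s).
  have -> : F s = (fun t => D s t * (D s t)^*).
    by apply/funext => t; rewrite /F normCK.
  by cont.
pose c (j l : 'I_n) :=
  n%:R^-1 * mean (fun t => toCx (u t) * ((circ t)^* ^+ j * circ t ^+ l)).
(* The subtraction of exponents is not truncated, since l < n. *)
pose Q : {poly Cx R} := \sum_(j < n) \sum_(l < n) c j l *: 'X^(n + j - l).
exists n, Q => s sI.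
have QE : Q.[circ s] =
    circ s ^+ n * (n%:R^-1 * mean (fun t => toCx (u t) * F s t)).
  rewrite (@eq_mean _ _ (fun t => \sum_(j < n) \sum_(l < n)
    (circ s ^+ j * (circ s)^* ^+ l) *
    (toCx (u t) * ((circ t)^* ^+ j * circ t ^+ l)))); last first.
    move=> t; rewrite /F normCK rmorph_sum /= mulr_suml mulr_sumr.
    apply: eq_bigr => j _; rewrite !mulr_sumr; apply: eq_bigr => l _.
    by rewrite rmorphXn rmorphM /= conjCK !exprMn; ring.
  rewrite mean_sum; last by move=> j; cont.
  rewrite horner_sum !mulr_sumr; apply: eq_bigr => j _.
  rewrite mean_sum; last by move=> l; cont.
  rewrite horner_sum !mulr_sumr; apply: eq_bigr => l _.
  rewrite hornerZ hornerXn meanZ; last by cont.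
  have -> : circ s ^+ (n + j - l) = circ s ^+ n * (circ s ^+ j * (circ s)^* ^+ l).
    rewrite mulrA -exprD -[in RHS](@subnK l (n + j)); last first.
      by rewrite (leq_trans (ltnW (ltn_ord l)))// leq_addr.
    by rewrite [in RHS]exprD -mulrA -exprMn circ_conj expr1n mulr1.
  by rewrite /c; ring.
have nE : n%:R^-1 * mean (F s) = 1.
  by rewrite mean_dirichlet_sq mulVf// gt_eqF.
have -> : toCx (u s) * circ s ^+ n - Q.[circ s] = circ s ^+ n *
    (n%:R^-1 * mean (fun t => toCx (u s - u t) * F s t)).
  rewrite QE (@eq_mean _ (fun t => toCx (u s - u t) * _)
    (fun t => toCx (u s) * F s t - toCx (u t) * F s t)).
    rewrite meanB; [|cont|cont]; rewrite (meanZ _ (cF s)) mean_dirichlet_sq; field.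
    by rewrite gt_eqF.
  by move=> t; rewrite toCxB mulrBl.
rewrite normrM normrX norm_circ expr1n mul1r normrM gtr0_norm ?invr_gt0//.
have cst : continuous (fun t => toCx (e / 2) * F s t + toCx (4 * C)).
  by apply: continuous_addf; [cont|exact: cst_continuous].
have le1 : `|mean (fun t => toCx (u s - u t) * F s t)| <=
    mean (fun t => toCx (e / 2) * F s t + toCx (4 * C)).
  apply: norm_mean_le => [|//|t tI].
    have -> : (fun t => toCx (u s - u t) * F s t) =
       (fun t => (toCx (u s) + - toCx (u t)) * F s t).
      by apply/funext => t; rewrite toCxB.
    by cont.
  rewrite normrM normr_toCx [X in _ * X]ger0_norm ?/F ?exprn_ge0//.
  apply: (@le_trans _ _ ((toCx (e / 2) + toCx C * `|circ s - circ t| ^+ 2)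
    * F s t)).
    by apply: ler_wpM2r; [rewrite exprn_ge0|exact: HC].
  rewrite mulrDl lerD2l -mulrA toCxM [toCx 4 * _]mulrC.
  apply: ler_wpM2l; first by rewrite [_ <= _]ler_toCx.
  rewrite mulrC toCx_nat; exact: dirichlet_dist_le.
rewrite (le_trans (ler_wpM2l _ le1)) ?invr_ge0 ?(ltW n0)//.
rewrite meanD; [|cont|exact: cst_continuous].
rewrite (meanZ _ (cF s)) mulrDr mulrCA nE mulr1.
have -> : mean (fun _ : R => toCx (4 * C)) = toCx (4 * C).
  rewrite (@eq_mean _ _ (fun=> toCx (4 * C) * 1)); last by move=> t; rewrite mulr1.
  by rewrite meanZ; [rewrite mean1 mulr1|exact: cst_continuous].
rewrite [n%:R^-1 * _]mulrC (_ : toCx e = toCx (e / 2) + toCx (e / 2)).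
  by rewrite lerD2l.
by rewrite -toCxD; congr toCx; lra.
Qed.

(** * Square summability of the rows of the transition matrix *)

(** The squared distance from p to its projection p_j z^j is nonnegative. *)
Lemma coef_sq_le_mean (R : realType) (p : {poly Cx R}) j :
  `|p`_j| ^+ 2 <= mean (fun t => p.[circ t] * (p.[circ t])^*).
Proof.
pose c := p`_j; pose g (t : R) := p.[circ t] * (circ t)^* ^+ j.
have mg : mean g = c := mean_coef p j.
have cg : continuous g by rewrite /g; cont.
have : 0 <= mean (fun t => (p.[circ t] * (p.[circ t])^* - c^* * g t) -
    (c * (g t)^* - c * c^*)).
  apply: mean_ge0 => [|t _]; first by cont.
  rewrite (_ : _ - _ = (p.[circ t] - c * circ t ^+ j) *
    (p.[circ t] - c * circ t ^+ j)^*); first by rewrite -normCK exprn_ge0.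
  have zj : circ t ^+ j * (circ t)^* ^+ j = 1.
    by rewrite -exprMn circ_conj expr1n.
  rewrite /g rmorphB !rmorphM /= !rmorphXn /= conjCK.
  by rewrite -[X in _ - (_ - X)]mulr1 -zj; ring.
rewrite meanB; [|by cont|by cont]; rewrite meanB; [|by cont|by cont].
rewrite meanB; [|by cont|by cont]; rewrite meanZ; last by cont.
rewrite meanZ; last by cont.
rewrite mean_conj; last by cont.
rewrite (@eq_mean _ (fun=> c * c^*) (fun=> c * c^* * 1)); last first.
  by move=> t; rewrite mulr1.
rewrite meanZ; last exact: cst_continuous.
rewrite mean1 mulr1 mg subrr subr0 mulrC -normCK.
by rewrite subr_ge0.
Qed.

Lemma weighted_ip_ge_mean (R : realType) (w : R -> R) (m : R) (p : {poly Cx R}) :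
  continuous w -> (forall t, m <= w t) ->
  toCx m * mean (fun t => p.[circ t] * (p.[circ t])^*) <= weighted_ip w p p.
Proof.
move=> cw mw; rewrite -meanZ; last by cont.
apply: mean_le; [by cont|by cont|move=> t _].
by rewrite ler_wpM2r ?ler_toCx// -normCK exprn_ge0.
Qed.

Lemma size_repr_kernel (R : realType) (P : nat -> {poly Cx R}) N i :
  (forall n, size (P n) = n.+1) -> (size (repr_kernel P N i) <= N)%N.
Proof.
move=> sP; apply/leq_sizeP => j Nj; rewrite coef_sum big_nat big1// => k /andP[_ kN].
by rewrite coefZ [(P k)`_j]nth_default ?mulr0// sP (leq_trans kN).
Qed.

(** With x the ith coefficient of the kernel k, the reproducing property gives
    <k, k> = x, while <k, k> >= m x^2. *)
Lemma repr_kernel_diag_le (R : realType) (w : R -> R) (m : R)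
    (P : nat -> {poly Cx R}) : continuous w -> 0 < m -> (forall t, m <= w t) ->
  (forall n, size (P n) = n.+1) ->
  (forall n k, weighted_ip w (P n) (P k) = (n == k)%:R) ->
  forall N i, (repr_kernel P N i)`_i <= toCx m^-1.
Proof.
move=> cw m0 mw sP oP N i; set k := repr_kernel P N i.
have kk : weighted_ip w k k = k`_i.
  by apply: (weighted_ip_repr_kernel cw sP oP); exact: size_repr_kernel.
have le : toCx m * `|k`_i| ^+ 2 <= k`_i.
  rewrite -[leRHS]kk (le_trans _ (weighted_ip_ge_mean _ cw mw))//.
  by rewrite ler_wpM2l ?coef_sq_le_mean// [_ <= _]ler_toCx ltW.
have k0 : 0 <= k`_i.
  by apply: le_trans le; rewrite mulr_ge0 ?exprn_ge0// [_ <= _]ler_toCx ltW.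
move: le; rewrite ger0_norm// -(toCx_Re k0); set x := complex.Re _ => le.
have {}le : m * x ^+ 2 <= x by rewrite -ler_toCx !toCxM.
have x0 : 0 <= x by rewrite -ler_toCx /x toCx_Re.
rewrite ler_toCx -[leRHS]mulr1 ler_pdivlMl//.
have [->|xn0] := eqVneq x 0; first by rewrite mulr0.
have xp : 0 < x by rewrite lt0r xn0.
by rewrite -(ler_pM2r xp) mul1r -mulrA -expr2.
Qed.

Lemma cvg_Cx (R : realType) (a b : nat -> R) : cvgn a -> cvgn b ->
  cvgn (fun n => toCx (a n) + 'i * toCx (b n)).
Proof.
have c (x : nat -> R) : cvgn x -> (fun n => toCx (x n)) @ \oo --> toCx (limn x).
  move=> cx; apply: (cvg_comp _ _ cx); exact: continuous_toCx.
move=> /c ca /c cb; apply: cvgP; apply: cvgD; first exact: ca.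
by apply: cvgM; [exact: cvg_cst|exact: cb].
Qed.

Lemma sum_nat_widenl (V : nmodType) (F : nat -> V) m N :
  \sum_(m <= k < N) F k = \sum_(0 <= k < N) (if (m <= k)%N then F k else 0).
Proof. by rewrite (big_nat_widenl m 0%N)//= big_mkcond. Qed.

(** The diagonal series bound the sums of squares along rows i and j, and
    |b_ik b_jk| <= |b_ik|^2 + |b_jk|^2 makes the series of products absolutely
    convergent; this is applied to the real and the imaginary parts. *)
Lemma conj_mul_tr_defined_bounded (R : realType) (B : infmx R) (c : R) :
  (forall i N, conj_mul_tr_partial B i i N <= toCx c) -> conj_mul_tr_defined B.
Proof.
move=> Bc i j; set k0 := maxn i j.
pose v k := if (k0 <= k)%N then complex.Re (`|B i k| ^+ 2 + `|B j k| ^+ 2) else 0.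
pose a k := if (k0 <= k)%N then (B i k)^* * B j k else 0.
have vE k : (k0 <= k)%N -> toCx (v k) = `|B i k| ^+ 2 + `|B j k| ^+ 2.
  by move=> kk; rewrite /v kk toCx_Re// addr_ge0 ?exprn_ge0.
have v0 k : 0 <= v k.
  rewrite -ler_toCx; have [kk|kk] := leqP k0 k.
    by rewrite vE// addr_ge0 ?exprn_ge0.
  by rewrite /v leqNgt kk.
have av k : `|a k| <= toCx (v k).
  have [kk|kk] := leqP k0 k; last by rewrite /a /v leqNgt kk /= normr0.
  rewrite vE// /a kk normrM norm_conjC.
  have : 0 <= (`|B i k| - `|B j k|) ^+ 2.
    by rewrite real_exprn_even_ge0// rpredB// normr_real.
  rewrite sqrrB addrAC subr_ge0 => H.
  apply: le_trans H; rewrite mulr2n lerDl mulr_ge0//.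
have partial_le l N : (l <= k0)%N ->
    \sum_(k0 <= k < N) `|B l k| ^+ 2 <= toCx c.
  move=> lk; apply: le_trans (Bc l N); rewrite /conj_mul_tr_partial maxnn.
  under [leRHS]eq_bigr do rewrite mulrC -normCK.
  have sq_ge0 (s : seq nat) : 0 <= \sum_(k <- s) `|B l k| ^+ 2.
    by apply: sumr_ge0 => k _; rewrite exprn_ge0.
  have [Nk|kN] := leqP N k0; first by rewrite [leLHS]big_geq//; exact: sq_ge0.
  by rewrite [leRHS](big_cat_nat lk (ltnW kN))/= lerDr; exact: sq_ge0.
have cv : cvgn (series v).
  apply: nondecreasing_is_cvgn; first exact: nondecreasing_series.
  exists (c + c) => _ [N _ <-]; rewrite -ler_toCx toCxD.
  rewrite /series /= toCx_sum.
  rewrite (eq_bigr (fun k =>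
    if (k0 <= k)%N then `|B i k| ^+ 2 + `|B j k| ^+ 2 else 0)); last first.
    by move=> k _; case: ifP => [/vE//|kk]; rewrite /v kk.
  rewrite -sum_nat_widenl big_split /=.
  by rewrite lerD// partial_le// leq_max leqnn ?orbT.
have cvpart (f : Cx R -> R) : (forall z, toCx `|f z| <= `|z|) ->
    cvgn (series (fun k => f (a k))).
  move=> fz; apply: normed_cvg; apply: (series_le_cvg _ _ _ cv) => k.
  - exact: normr_ge0.
  - exact: v0.
  - by rewrite -ler_toCx; exact: le_trans (fz _) (av k).
have -> : conj_mul_tr_partial B i j = fun N =>
    toCx (series (fun k => complex.Re (a k)) N) +
    'i * toCx (series (fun k => complex.Im (a k)) N).
  apply/funext => N; rewrite /conj_mul_tr_partial sum_nat_widenl.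
  rewrite /series /= !toCx_sum.
  by rewrite mulr_sumr -big_split /=; apply: eq_bigr => k _; rewrite -Cx_rect.
by apply: cvg_Cx; apply: cvpart; [exact: ler_Re_norm|exact: ler_Im_norm].
Qed.

(** * Comparison of the kernel with the reciprocal weight *)

(** The threshold d is the degree of a trigonometric approximation of 1 / w; it
    is also the distance from the corner beyond which q below is a polynomial.
    Once N exceeds the degree of q, the difference p lies in the space on which
    the kernel reproduces coefficients. *)
Lemma repr_kernel_asymptotics (R : realType) (w : R -> R) (m : R)
    (P : nat -> {poly Cx R}) (e : R) :
  continuous w -> (forall s t : R, expi s = expi t -> w s = w t) ->
  0 < m -> (forall t, m <= w t) ->
  (forall n, size (P n) = n.+1) ->
  (forall n k, weighted_ip w (P n) (P k) = (n == k)%:R) -> 0 < e ->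
  exists d, forall i j, (d <= i)%N -> exists N0, forall N, (N0 <= N)%N ->
    `|(repr_kernel P N i)`_j -
      mean (fun t => toCx (1 / w t) * (circ t ^+ i * (circ t)^* ^+ j))| <= toCx e.
Proof.
move=> cw wE m0 mw sP oP e0.
have w0 t : 0 < w t := lt_le_trans m0 (mw t).
have [M MP] : exists M, forall t, t \in `[0, 2 * pi] -> w t <= M.
  have [c _ cP] := EVT_max (ltW (twopi_gt0 R)) (continuous_subspaceT cw).
  by exists (w c) => t /cP.
have M0 : 0 < M.
  by apply: lt_le_trans (w0 0) (MP _ _); rewrite in_itv/= lexx ltW// twopi_gt0.
pose u t := 1 / w t.
have cu : continuous u.
  move=> t; rewrite /u; apply: cvgM; first exact: cvg_cst.
  by apply: cvgV; [rewrite gt_eqF|exact: cw].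
have uE s t : expi s = expi t -> u s = u t by move=> /wE st; rewrite /u st.
(* The final error is e1 from the coefficients of q plus M * e1 / m from p. *)
pose e1 := e / (M / m + 1).
have Mm0 : 0 < M / m + 1 by rewrite addr_gt0// divr_gt0.
have e10 : 0 < e1 by rewrite divr_gt0.
have [d [Q QP]] := trig_approx cu uE e10.
exists d => i j di; pose q := 'X^(i - d) * Q.
exists (size q) => N qN.
set K := repr_kernel P N i; pose p := q - K.
have qE t : q.[circ t] = circ t ^+ (i - d) * Q.[circ t].
  by rewrite hornerM hornerXn.
have zE t : circ t ^+ i = circ t ^+ (i - d) * circ t ^+ d.
  by rewrite -exprD subnK.
have uq t : t \in `[0, 2 * pi] ->
    `|toCx (u t) * circ t ^+ i - q.[circ t]| <= toCx e1.
  move=> /QP; rewrite qE zE mulrCA -mulrBr normrM normrX norm_circ expr1n.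
  by rewrite mul1r.
have qj : `|q`_j - mean (fun t => toCx (u t) * (circ t ^+ i * (circ t)^* ^+ j))|
    <= toCx e1.
  rewrite -mean_coef -meanB; [|by cont|by cont].
  have -> : toCx e1 = mean (fun _ : R => toCx e1).
    rewrite (@eq_mean _ (fun=> toCx e1) (fun=> toCx e1 * 1)).
      by rewrite meanZ; [rewrite mean1 mulr1|exact: cst_continuous].
    by move=> t; rewrite mulr1.
  apply: norm_mean_le => [||t /uq]; [by cont|exact: cst_continuous|].
  rewrite mulrA -mulrBl normrM normrX norm_conjC norm_circ expr1n mulr1.
  by rewrite distrC.
pose dl := M * e1; have dl0 : 0 < dl by rewrite mulr_gt0.
pose h t := toCx (w t) * q.[circ t] - circ t ^+ i.
have ch : continuous h by rewrite /h; cont.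
have hle t : t \in `[0, 2 * pi] -> `|h t| <= toCx dl.
  move=> tI; have -> : h t =
      - (toCx (w t) * (toCx (u t) * circ t ^+ i - q.[circ t])).
    have wu : toCx (w t) * toCx (u t) = 1.
      by rewrite -toCxM /u div1r mulfV ?gt_eqF//; exact: toCx_nat R 1.
    by rewrite mulrBr mulrA wu mul1r opprB.
  rewrite normrN normrM normr_toCx (gtr0_norm (w0 t)) (toCxM M e1).
  apply: ler_pM => //; first by rewrite [_ <= _]ler_toCx ltW.
    by rewrite ler_toCx MP.
  exact: uq.
have sp : (size p <= N)%N.
  rewrite (leq_trans (size_polyD _ _))// geq_max size_polyN qN.
  exact: size_repr_kernel.
pose S := mean (fun t => p.[circ t] * (p.[circ t])^*).
have Sr : 0 <= S.
  apply: mean_ge0 => [|t _]; first by cont.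
  by rewrite -normCK exprn_ge0.
have pp : weighted_ip w p p = mean (fun t => h t * (p.[circ t])^*).
  have Kp : weighted_ip w K p = mean (fun t => circ t ^+ i * (p.[circ t])^*).
    rewrite weighted_ipC// (weighted_ip_repr_kernel cw sP oP)// -mean_coef -mean_conj.
      by apply: eq_mean => t; rewrite rmorphM rmorphXn /= conjCK mulrC.
    by cont.
  have -> : weighted_ip w p p = weighted_ip w q p - weighted_ip w K p.
    by rewrite /p weighted_ipDl// -[- K]scaleN1r weighted_ipZl// mulN1r.
  rewrite Kp /weighted_ip -meanB; [|by cont|by cont].
  by apply: eq_mean => t; rewrite /h; ring.
(* The inequality dl r <= dl^2 / (2 m) + m r^2 / 2 leaves half of m S to be
   absorbed on the left. *)
have Sle : toCx m * S <= toCx (dl ^+ 2 / (2 * m)) + toCx (m / 2) * S.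
  apply: le_trans (weighted_ip_ge_mean _ cw mw) _; rewrite pp.
  have pp0 : 0 <= mean (fun t => h t * (p.[circ t])^*).
    rewrite -pp; apply: le_trans (weighted_ip_ge_mean _ cw mw).
    by rewrite mulr_ge0// [_ <= _]ler_toCx ltW.
  rewrite -[leLHS]ger0_norm//.
  have -> : toCx (dl ^+ 2 / (2 * m)) + toCx (m / 2) * S =
      mean (fun t => toCx (dl ^+ 2 / (2 * m)) * 1 +
        toCx (m / 2) * (p.[circ t] * (p.[circ t])^*)).
    rewrite meanD; [|exact: cst_continuous|by cont].
    rewrite meanZ; last exact: cst_continuous.
    by rewrite mean1 mulr1 meanZ; [|cont].
  apply: norm_mean_le => [||t tI]; [by cont| |].
    by apply: continuous_addf; [exact: cst_continuous|cont].
  rewrite mulr1 normrM norm_conjC -normCK.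
  rewrite -(toCx_Re (normr_ge0 p.[circ t])); set r := complex.Re _.
  have r0 : 0 <= r by rewrite -ler_toCx /r toCx_Re; exact: normr_ge0.
  apply: (@le_trans _ _ (toCx dl * toCx r)).
    by apply: ler_wpM2r; [rewrite [_ <= _]ler_toCx|exact: hle].
  rewrite [toCx r ^+ 2]expr2 -!toCxM -toCxD ler_toCx -subr_ge0.
  rewrite (_ : _ - _ = (dl - m * r) ^+ 2 / (2 * m)); last first.
    by field; rewrite gt_eqF.
  by rewrite divr_ge0 ?sqr_ge0// mulr_ge0// ltW.
have pj : `|p`_j| <= toCx (dl / m).
  have dm0 : 0 <= toCx (dl / m) by rewrite [_ <= _]ler_toCx divr_ge0// ltW.
  rewrite -(@ler_pXn2r _ 2)// ?nnegrE//.
  apply: le_trans (coef_sq_le_mean p j) _; rewrite -/S.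
  move: Sle; rewrite -(toCx_Re Sr); set s := complex.Re _.
  rewrite [toCx (dl / m) ^+ 2]expr2 -!toCxM -toCxD !ler_toCx => Sle.
  have {}Sle : m / 2 * s <= dl ^+ 2 / (2 * m) by lra.
  rewrite -(@ler_pM2l _ (m / 2)) ?divr_gt0//.
  rewrite (_ : m / 2 * (dl / m * (dl / m)) = dl ^+ 2 / (2 * m))//.
  by field; rewrite gt_eqF.
set T := mean _ in qj *.
rewrite (_ : K`_j - T = (q`_j - T) - p`_j); last by rewrite coefB; ring.
apply: le_trans (ler_normB _ _) _.
apply: le_trans (lerD qj pj) _; rewrite -toCxD ler_toCx.
rewrite (_ : e1 + dl / m = e)//.
rewrite /dl /e1; field.
by rewrite !gt_eqF// addr_gt0.
Qed.

Lemma circle_continuous (R : realType) (phi : Cx R -> R) :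
  {within unit_circle R, continuous phi} ->
  continuous (fun t : R => phi (expi t)).
Proof.
move=> /subspace_continuousP cphi t.
have ut : unit_circle R (expi t) by exact: norm_expi.
apply: (cvg_comp _ _ _ (cphi _ ut)).
move=> A /=; rewrite /within /= => HA.
apply: (@filterS _ (nbhs t) _ _ _ _ (@continuous_expi R t _ HA)) => s; apply.
exact: norm_expi.
Qed.

Theorem proposition3 (R : realType) (phi : Cx R -> R)
    (phi_cont : {within unit_circle R, continuous phi})
    (phi_inf : 0 < inf (phi @` unit_circle R))
    (T_HPD : HPD (toeplitz (fun z => toCx (phi z))))
    (P : nat -> {poly Cx R})
    (P_orthonormal :
       orthonormal_polys (toeplitz (fun z => toCx (phi z))) P) :
  let A := conj_mul_tr (transition_matrix P) in
  [/\ conj_mul_tr_defined (transition_matrix P),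
      weakly_asymptotic_toeplitz A
    & Lim A = toeplitz (fun z => toCx (1 / phi z))].
Proof.
move=> A; have [sP _ oM] := P_orthonormal.
pose w (t : R) := phi (expi t); pose m := inf (phi @` unit_circle R).
have cw : continuous w := circle_continuous phi_cont.
have mw t : m <= w t.
  (* The infimum of a set without lower bound is 0, which is excluded. *)
  have lb : has_lbound (phi @` unit_circle R).
    apply: contrapT => nlb; move: phi_inf; rewrite inf_out ?ltxx// => -[_].
    exact: nlb.
  by apply: ge_inf => //; exists (expi t) => //; exact: norm_expi.
have wE s t : expi s = expi t -> w s = w t by rewrite /w => ->.
have oP n k : weighted_ip w (P n) (P k) = (n == k)%:R by rewrite -inner_toeplitz.
pose T := toeplitz (fun z => toCx (1 / phi z)).
have def : conj_mul_tr_defined (transition_matrix P).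
  apply: (@conj_mul_tr_defined_bounded _ _ m^-1) => i N.
  by rewrite -coef_repr_kernel//; exact: repr_kernel_diag_le cw phi_inf mw sP oP _ _.
have AT (e : R) : 0 < e -> exists d, forall i j, (d <= i)%N ->
    `|A i j - T i j| <= toCx e.
  move=> e0; have e20 : 0 < e / 2 by rewrite divr_gt0.
  have [d dP] := repr_kernel_asymptotics cw wE phi_inf mw sP oP e20.
  exists d => i j di; have [N0 NP] := dP i j di.
  have e20' : 0 < toCx (e / 2) by rewrite ltr_toCx.
  have cA : conj_mul_tr_partial (transition_matrix P) i j @ \oo --> A i j.
    exact: def.
  have /(@cvgr_dist_lt _ _ _ _ _ _ _ cA)[N1 _ N1P] := e20'.
  pose N := maxn N0 N1.
  have h0 := NP N (leq_maxl _ _); have h1 := N1P N (leq_maxr _ _).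
  rewrite coef_repr_kernel// in h0.
  rewrite -(toeplitz_mean (fun z => toCx (1 / phi z))) in h0.
  rewrite -(subrKA (conj_mul_tr_partial (transition_matrix P) i j N)).
  apply: le_trans (ler_normD _ _) _; apply: le_trans (lerD (ltW h1) h0) _.
  rewrite -toCxD ler_toCx; lra.
have AL (k : int) : shifted_diag A k @ \oo -->
    fourier_coef (fun z => toCx (1 / phi z)) (- k).
  apply/cvgrPdist_le => e e0.
  have e0' : 0 < complex.Re e by rewrite -ltr_toCx toCx_Re// ltW.
  have [d dP] := AT _ e0'.
  exists (maxn d `|k|) => // n /=; rewrite geq_max => /andP[dn kn].
  have <- : T n (absz (n%:Z + k)) = fourier_coef (fun z => toCx (1 / phi z)) (- k).
    by congr fourier_coef; lia.
  rewrite distrC; apply: le_trans (dP _ _ dn) _.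
  by rewrite toCx_Re// ltW.
split; [exact: def|by move=> k; apply: cvgP (AL k)|].
apply/funext => i; apply/funext => j; rewrite /Lim (cvg_lim _ (AL _));
  last exact: norm_hausdorff.
by rewrite /toeplitz opprB.
Qed.
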